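(* Let $T$ be a tree and let $l \colon V(T) \to \mathbb{R}^+$ be a non-degenerate labeling. Then the following statements are equivalent: (i) The ultrametric space $(V(T), d_l)$ is locally finite. (ii) The ultrametric spaces $(V(R), d_l|_{V(R) \times V(R)})$ and $(V(S), d_l|_{V(S) \times V(S)})$ are locally finite for all rays $R \subseteq T$ and all star graphs $S \subseteq T$.
   Context: Graphs are simple and undirected: $G=(V(G),E(G))$ with $E(G)$ a set of unordered pairs of distinct vertices; vertex sets may be infinite of any cardinality. $G_1\subseteq G$ means $G_1$ is a subgraph of $G$: $V(G_1)\subseteq V(G)$ and $E(G_1)\subseteq E(G)$. A tree is a connected graph with nonempty vertex set and no cycles; any two distinct vertices of a tree are joined by exactly one (finite) path. A ray is an infinite graph $R$ with $V(R)=\{x_1,x_2,\ldots\}$, all $x_n$ distinct, and $E(R)=\{\{x_n,x_{n+1}\}\colon n\in\mathbb{N}\}$. A star graph is a tree $S$ having a vertex $c$ (the center) adjacent to every $v\in V(S)\setminus\{c\}$. $\mathbb{R}^+ = [0,\infty)$. A labeling of a tree $T$ is a map $l \colon V(T)\to\mathbb{R}^+$; it is non-degenerate if $\max\{l(u),l(v)\}>0$ for every edge $\{u,v\}\in E(T)$. Given a labeling $l$, define $d_l\colon V(T)\times V(T)\to\mathbb{R}^+$ by $d_l(u,u)=0$ and, for $u\neq v$, $d_l(u,v)=\max_{w\in V(P)} l(w)$, where $P$ is the path joining $u$ and $v$ in $T$ (endpoints included). It is known that $d_l$ is an ultrametric on $V(T)$ if and only if $l$ is non-degenerate. A subset $A$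 of a metric space $(X,d)$ is bounded if $A\subseteq B_r(c)=\{x\in X\colon d(c,x)\le r\}$ for some $c\in X$, $r>0$. A metric space is locally finite if every bounded subset of it is finite. *)

(* Defs.v *)
From mathcomp Require Import all_boot all_order all_algebra.
From mathcomp Require Import all_classical all_reals.

Set Implicit Arguments.
Unset Strict Implicit.
Unset Printing Implicit Defensive.

Import Order.TTheory GRing.Theory Num.Theory.
Local Open Scope classical_set_scope.
Local Open Scope ring_scope.

(* The vertices are elements of an ambient type U, so that a graph and its
   subgraphs have the same type. U and vertex G may be infinite; the unordered
   edge {u, v} is encoded by the symmetric relation edge G. *)
Record graph (U : choiceType) := Graph {
  vertex : set U;
  edge : rel U;
  edge_sym : symmetric edge;
  edge_irrefl : irreflexive edge;
  edge_vertex : forall u v, edge u v -> vertex u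
}.

Definition subgraph (U : choiceType) (H G : graph U) : Prop :=
  vertex H `<=` vertex G /\ (forall u v, edge H u v -> edge G u v).

(* The vertices of the path, in order, are u :: p. *)
Definition is_path (U : choiceType) (G : graph U) (u v : U) (p : seq U) : Prop :=
  [/\ vertex G u, path (edge G) u p, uniq (u :: p) & last u p = v].

Definition connected_graph (U : choiceType) (G : graph U) : Prop :=
  forall u v, vertex G u -> vertex G v -> exists p, is_path G u v p.

(* In a simple graph, a cycle has at least three vertices; ucycle alone also
   holds for [::] and for [:: u; v] when {u, v} is an edge. *)
Definition acyclic_graph (U : choiceType) (G : graph U) : Prop :=
  forall c : seq U, (2 < size c)%N -> ~ ucycle (edge G) c.

Definition is_tree (U : choiceType) (G : graph U) : Prop :=
  [/\ vertex G !=set0, connected_graph G & acyclic_graph G].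

Definition is_ray (U : choiceType) (G : graph U) : Prop :=
  exists x : nat -> U,
    [/\ injective x,
        vertex G = range x
      & forall u v, edge G u v <->
          exists n, (u = x n /\ v = x n.+1) \/ (u = x n.+1 /\ v = x n)].

Definition is_star (U : choiceType) (G : graph U) : Prop :=
  is_tree G /\
  exists2 c, vertex G c & forall v, vertex G v -> v <> c -> edge G c v.

(* Only the values of l on vertex T matter. *)
Definition is_labeling (R : realType) (U : choiceType) (T : graph U)
    (l : U -> R) : Prop :=
  forall v, vertex T v -> 0 <= l v.

Definition non_degenerate (R : realType) (U : choiceType) (T : graph U)
    (l : U -> R) : Prop :=
  forall u v, edge T u v -> 0 < Num.max (l u) (l v).

(* When T is a tree and u, v are vertices of T, this is the unique path. *)
Definition joining_path (U : choiceType) (T : graph U) (u v : U) : seq U :=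
  xget [::] [set p | is_path T u v p].

(* The base value 0 of the maximum is harmless, labels being nonnegative. *)
Definition label_dist (R : realType) (U : choiceType) (T : graph U)
    (l : U -> R) (u v : U) : R :=
  if u == v then 0
  else \big[Num.max/0]_(w <- u :: joining_path T u v) l w.

(* A metric space is given by its set of points X : set U and a distance
   d : U -> U -> R, of which only the restriction to X is used. *)
Definition bounded_subset (R : realType) (U : choiceType) (X : set U)
    (d : U -> U -> R) (A : set U) : Prop :=
  A `<=` X /\
  exists c r, [/\ X c, 0 < r & A `<=` [set x | X x /\ d c x <= r]].

Definition locally_finite (R : realType) (U : choiceType) (X : set U)
    (d : U -> U -> R) : Prop :=
  forall A : set U, bounded_subset X d A -> finite_set A.

(* Main.v *)
Require Import Defs.
From mathcomp Require Import all_boot all_order all_algebra.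
From mathcomp Require Import all_classical all_reals.

Set Implicit Arguments.
Unset Strict Implicit.
Unset Printing Implicit Defensive.

Import Order.TTheory GRing.Theory Num.Theory.
Local Open Scope classical_set_scope.
Local Open Scope ring_scope.

(** A bounded set of a subgraph of [T] is bounded in [T], so local finiteness
    passes from [T] to all its subgraphs; only the converse has content.

    Suppose the ball of radius [r] around [c] is infinite. Paths of a tree are
    unique ([acyclic_path_uniq]), so the distance from [u] to [v <> u] is read
    off any path from [u] to [v]: it is at most [r] exactly when all labels on
    that path are ([label_dist_le]). The points of the ball thus correspond to
    the paths from [c] ending in it, a set of finite sequences closed under
    prefixes. Koenig's lemma ([koenig]) leaves two cases. Either some such
    path, ending in [v] say, has infinitely many one-step extensions; the star
    at [v] formed by the last vertices of these extensions lies in [T], and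
    all its labels are at most [r], so it is bounded and infinite. Or there is
    an infinite sequence all of whose prefixes are such paths; its vertices
    form a ray of [T] inside the ball. In both cases an infinite bounded star
    or ray contradicts the hypothesis. *)

(** * Infinite sets of finite sequences *)

(** Extend the empty sequence one entry at a time, keeping infinitely many
    continuations: when [p] has infinitely many continuations in [Q] but only
    finitely many one-step extensions, one of the latter still has infinitely
    many. *)
Lemma koenig (U : Type) (Q : set (seq U)) :
  infinite_set Q ->
  (forall p a, Q (rcons p a) -> Q p) ->
  (forall p, Q p -> finite_set [set a | Q (rcons p a)]) ->
  exists x : nat -> U, forall n, Q (mkseq x n).
Proof.
move=> Qinf Qrcons Qfin.
have Qcat q : forall p, Q (p ++ q) -> Q p.
  elim: q => [|a q IHq] p; first by rewrite cats0.
  by rewrite -cat_rcons => /IHq/Qrcons.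
pose cont p := [set q | Q (p ++ q)].
have contQ p : infinite_set (cont p) -> Q p.
  move=> pinf; apply: contrapT => NQp; apply: pinf.
  suff -> : cont p = set0 by exact: finite_set0.
  by rewrite -subset0 => q /Qcat.
have step p : exists a, infinite_set (cont p) -> infinite_set (cont (rcons p a)).
  have [pinf|pfin] := pselect (infinite_set (cont p)); last first.
    (* Any entry will do; were there none, [Q] would be within [set [::]]. *)
    apply: contrapT => noext; apply: Qinf.
    apply: (@sub_finite_set _ _ [set [::]]); last exact: finite_set1.
    by move=> [|a q] // _; case: noext; exists a => /pfin.
  apply: contrapT => noext; apply: (pinf).
  apply: (@sub_finite_set _ _ ([set [::]] `|`
      \bigcup_(a in [set a | Q (rcons p a)]) (cons a @` cont (rcons p a)))).
    move=> [|a q]; first by left.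
    rewrite /cont /= => Qpaq; right; exists a => /=.
      by apply: (Qcat q); rewrite cat_rcons.
    by exists q => //; rewrite /cont /= cat_rcons.
  rewrite finite_setU; split; first exact: finite_set1.
  apply: bigcup_finite; first exact/Qfin/contQ.
  move=> a _; apply: finite_image; apply: contrapT => ainf.
  by apply: noext; exists a.
have [next nextP] := choice step.
pose p n := iter n (fun s => rcons s (next s)) [::].
exists (fun n => next (p n)) => n.
suff -> : mkseq (fun n => next (p n)) n = p n.
  apply: contQ; elim: n => [|n IHn]; first exact: Qinf.
  exact: nextP.
by elim: n => // n IHn; rewrite mkseqS IHn.
Qed.

(** * Paths in acyclic graphs *)

Section Graphs.
Variable U : choiceType.
Implicit Types (G H : graph U) (u v c : U) (p q : seq U).

Lemma edge_vertexr G u v : edge G u v -> vertex G v.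
Proof. by rewrite edge_sym; exact: edge_vertex. Qed.

Lemma subgraph_acyclic G H :
  subgraph H G -> acyclic_graph G -> acyclic_graph H.
Proof.
move=> [_ sE] acG s s2 /andP[cs us]; apply: (acG s s2); apply/andP; split=> //.
by apply: sub_cycle cs; exact: sE.
Qed.

(** Follow the two paths up to the first vertex where they part. From there
    they run without meeting that vertex again, so joining the first one to
    the reverse of the second and cutting out loops closes a cycle. *)
Lemma acyclic_path_uniq G u v p q :
  acyclic_graph G -> is_path G u v p -> is_path G u v q -> p = q.
Proof.
move=> acG; elim: p u q => [|a p IHp] u [|b q] //.
- by move=> [_ _ _ /= <-] [_ _ /= /andP[uq _] E]; rewrite -E mem_last in uq.
- by move=> [_ _ /= /andP[uq _] E] [_ _ _ /= E']; rewrite E' -E mem_last in uq.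
move=> [_ /= /andP[ua pa] /andP[Nu upa] lp] [_ /= /andP[ub qb] /andP[Nu' uqb] lq].
have [eqab|neqab] := eqVneq a b.
  move: eqab ub qb Nu' uqb lq => <- ub qb Nu' uqb lq.
  by congr cons; apply: (IHp a) => //; split=> //; exact: edge_vertexr ua.
(* [w] is the walk from [b] along [q] to [v] and back along [p] to [a]. *)
pose w := q ++ rev (belast a p).
have pathw : path (edge G) b w.
  rewrite cat_path qb /= lq -lp rev_path.
  by under eq_path do rewrite edge_sym.
have lastw : last b w = a.
  rewrite /w last_cat lq -lp; case: (p) => //= d s.
  by rewrite rev_cons last_rcons.
have uw : u \notin b :: w.
  rewrite -cat_cons mem_cat negb_or Nu' mem_rev /=.
  by apply: contra Nu => /mem_belast.
case/shortenP: pathw lastw => s ps us sw lasts.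
have s0 : (0 < size s)%N.
  by case: (s) lasts => //= E; rewrite E eqxx in neqab.
case: (acG [:: u, b & s]) => //.
apply/andP; split.
  by rewrite /= rcons_path ub ps /= lasts edge_sym.
rewrite cons_uniq us andbT; apply: contra uw.
by rewrite !inE => /predU1P[->|/sw ->]; rewrite ?eqxx ?orbT.
Qed.

Lemma is_path_rcons G u p a v :
  is_path G u v (rcons p a) -> is_path G u (last u p) p.
Proof.
move=> [uG]; rewrite rcons_path -rcons_cons rcons_uniq.
by move=> /andP[pp _] /andP[_ up] _; split.
Qed.

Lemma joining_pathE G u v p :
  acyclic_graph G -> is_path G u v p -> joining_path G u v = p.
Proof.
move=> acG pp; apply: (acyclic_path_uniq acG _ pp).
exact: (@xgetPex _ [::] [set q | is_path G u v q] (ex_intro _ p pp)).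
Qed.

(** * The distance of a labeling *)

Section LabelDist.
Variables (R : realType) (l : U -> R).

(** The empty path is an exception because the distance from [u] to itself
    is 0 whatever the label of [u]. *)
Lemma label_dist_le G u v p r :
  acyclic_graph G -> is_path G u v p -> 0 <= r ->
  (label_dist G l u v <= r) = (p == [::]) || all (fun w => l w <= r) (u :: p).
Proof.
move=> acG pp r0; rewrite /label_dist (joining_pathE acG pp).
have -> : (u == v) = (p == [::]).
  case: pp => _ _; case: p => [|a p] /=; first by move=> _ ->; rewrite !eqxx.
  by move=> /andP[uq _] <-; apply/eqP => E; rewrite {1}E mem_last in uq.
case: eqP => [//|_]; rewrite orFb.
apply/idP/allP => [le w wp|le].
  by apply: le_trans le; exact: le_bigmax_seq.
by rewrite big_seq; apply: bigmax_le.
Qed.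

End LabelDist.

(** * Rays and stars in a graph *)

Section Ray.
Variables (y : nat -> U) (y_inj : injective y).

Let ray_edge u v :=
  `[< exists n, (u = y n /\ v = y n.+1) \/ (u = y n.+1 /\ v = y n) >].

Fact ray_edge_sym : symmetric ray_edge.
Proof.
by move=> u v; apply/asboolP/asboolP => -[n [[-> ->]|[-> ->]]]; exists n; auto.
Qed.

Fact ray_edge_irrefl : irreflexive ray_edge.
Proof.
by move=> u; apply/asboolP => -[n [[-> /y_inj/n_Sn]|[-> /y_inj/esym/n_Sn]]].
Qed.

Fact ray_edge_vertex u v : ray_edge u v -> range y u.
Proof. by case/asboolP => n [[-> _]|[-> _]]; [exists n|exists n.+1]. Qed.

Definition ray_graph := Graph ray_edge_sym ray_edge_irrefl ray_edge_vertex.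

Lemma ray_graph_is_ray : is_ray ray_graph.
Proof. by exists y; split=> // u v; split=> /asboolP. Qed.

Lemma ray_graph_sub G :
  (forall n, edge G (y n) (y n.+1)) -> subgraph ray_graph G.
Proof.
move=> yG; split=> [_ [n _ <-]|u v /asboolP[n [[-> ->]|[-> ->]]]] //.
- exact: edge_vertex (yG n).
- by rewrite edge_sym.
Qed.

End Ray.

Section Star.
Variables (G : graph U) (c : U) (N : set U).
Hypotheses (acG : acyclic_graph G) (cG : vertex G c).
Hypothesis NG : forall a, N a -> edge G c a.

Let star_edge u v := `[< (u = c /\ N v) \/ (v = c /\ N u) >].

Fact star_edge_sym : symmetric star_edge.
Proof. by move=> u v; apply/asboolP/asboolP => -[]; auto. Qed.

Fact star_edge_irrefl : irreflexive star_edge.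
Proof.
by move=> u; apply/asboolP => -[] [-> /NG]; rewrite edge_irrefl.
Qed.

Fact star_edge_vertex u v : star_edge u v -> (c |` N) u.
Proof. by move=> /asboolP[[-> _]|[_ Nu]]; [left|right]. Qed.

Definition star_graph := Graph star_edge_sym star_edge_irrefl star_edge_vertex.

Lemma star_graph_sub : subgraph star_graph G.
Proof.
split=> [a [->//|/NG/edge_vertexr//]|u v /asboolP[[-> /NG//]|[-> /NG]]].
by rewrite edge_sym.
Qed.

(** The star needs no separate check for cycles: it is a subgraph of [G]. *)
Lemma star_graph_is_star : is_star star_graph.
Proof.
have cv v : N v -> star_edge c v by move=> Nv; apply/asboolP; left.
split; last by exists c => [|v [->//|/cv]]; [left|].
split; [by exists c; left| |exact: subgraph_acyclic star_graph_sub acG].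
move=> u v uS vS.
have [<-|uv] := eqVneq u v; first by exists [::]; split.
case: (uS) => [uc|Nu]; case: (vS) => [vc|Nv].
- by rewrite uc vc eqxx in uv.
- exists [:: v]; split=> //=; last by rewrite inE uv.
  by rewrite uc andbT cv.
- exists [:: v]; split=> //=; last by rewrite inE uv.
  by rewrite vc andbT star_edge_sym cv.
have neq a : N a -> a != c.
  by move=> /NG ca; apply/eqP => ac; rewrite ac edge_irrefl in ca.
exists [:: c; v]; split=> //=.
  by rewrite star_edge_sym !cv.
by rewrite !inE negb_or uv neq //= eq_sym neq.
Qed.

End Star.
End Graphs.

(** * Local finiteness *)

Lemma locally_finite_subset (R : realType) (U : choiceType) (X Y : set U)
    (d : U -> U -> R) :
  Y `<=` X -> locally_finite X d -> locally_finite Y d.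
Proof.
move=> YX Xfin A [AY [c [r [Yc r0 Ar]]]]; apply: Xfin.
split; first exact: subset_trans YX.
by exists c, r; split; [exact: YX| |move=> x /Ar[/YX]].
Qed.

Theorem theorem3 (R : realType) (U : choiceType) (T : graph U) (l : U -> R)
    (hT : is_tree T) (hl : is_labeling T l) (hnd : non_degenerate T l) :
  locally_finite (vertex T) (label_dist T l) <->
  ((forall Ry : graph U, is_ray Ry -> subgraph Ry T ->
      locally_finite (vertex Ry) (label_dist T l)) /\
   (forall S : graph U, is_star S -> subgraph S T ->
      locally_finite (vertex S) (label_dist T l))).
Proof.
split=> [Tfin|[rayfin starfin]].
  by split=> H _ [HT _]; exact: locally_finite_subset Tfin.
case: hT => _ conT acT A [AT [c [r [cT r0 Ar]]]].
have r0' := ltW r0.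
pose Q := [set p | is_path T c (last c p) p /\
                   label_dist T l c (last c p) <= r].
apply: (@sub_finite_set _ _ (last c @` Q)).
  move=> v Av; have [p pp] := conT c v cT (AT v Av).
  have lp : last c p = v by case: pp.
  by exists p => //; split; rewrite lp //; have [] := Ar v Av.
apply: finite_image; apply: contrapT => Qinf.
have Qrcons p a : Q (rcons p a) -> Q p.
  move=> [pp dp]; have pp' := is_path_rcons pp; split=> //.
  move: dp; rewrite (label_dist_le l acT pp r0') (label_dist_le l acT pp' r0').
  by rewrite -rcons_cons all_rcons; case: p {pp pp'} => //= b p /andP[_ ->].
have Qfin p : Q p -> finite_set [set a | Q (rcons p a)].
  (* The leaves [N] of the star at [v] lie in the ball of radius [r] around
     [v], so they are finite in number by hypothesis. *)
  move=> Qp; set v := last c p; set N := [set _ | _].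
  have NP a : N a -> [/\ edge T v a, l v <= r & l a <= r].
    move=> [pp]; rewrite (label_dist_le l acT pp r0').
    rewrite -rcons_cons all_rcons -size_eq0 size_rcons /=.
    rewrite -/(all _ (c :: p)) => /andP[la /allP lp].
    split=> //; last exact: lp (mem_last c p).
    by case: pp => _; rewrite rcons_path => /andP[].
  have NT a : N a -> edge T v a by case/NP.
  have vT : vertex T v.
    case: Qp => -[_ + _ _] _; rewrite /v; case/lastP: p @v N NP NT => // p b.
    by rewrite last_rcons rcons_path => _ _ _ _ /andP[_] /edge_vertexr.
  apply: (starfin _ (star_graph_is_star acT vT NT) (star_graph_sub vT NT)).
  split=> [a Na|]; first by right.
  exists v, r; split=> //; first by left.
  move=> a Na; split; first by right.
  have [va lv la] := NP a Na.
  have pva : is_path T v a [:: a].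
    split=> //=; first by rewrite va.
    rewrite inE andbT; apply/eqP => E.
    by move: va; rewrite {1}E edge_irrefl.
  by rewrite (label_dist_le l acT pva r0') /= lv la.
(* No path from [c] has infinitely many extensions in the ball, so there is an
   infinite one; [y] lists its vertices, [y 0] being [c] itself. *)
have [x Qx] := koenig Qinf Qrcons Qfin.
pose y n := last c (mkseq x n).
have yS n : y n.+1 = x n by rewrite /y mkseqS last_rcons.
have consx n : c :: mkseq x n = mkseq y n.+1.
  elim: n => // n IHn.
  by rewrite [mkseq x _]mkseqS -rcons_cons IHn [RHS]mkseqS yS.
have y_inj : injective y.
  move=> m n; have [[_ _ + _] _] := Qx (maxn m n); rewrite consx.
  by move=> /mkseq_uniqP; apply; rewrite inE ltnS ?leq_maxl ?leq_maxr.
have yT n : edge T (y n) (y n.+1).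
  by have [[_ + _ _] _] := Qx n.+1; rewrite mkseqS rcons_path yS => /andP[].
have yfin : finite_set (range y).
  apply: (rayfin _ (ray_graph_is_ray y_inj) (ray_graph_sub y_inj yT)).
  split=> //; exists c, r; split=> //; first by exists 0%N.
  by move=> _ [n _ <-]; split; [exists n|have [] := Qx n].
apply: infinite_nat; apply: (sub_finite_set _ (finite_preimage _ yfin)).
  by move=> n _; exists n.
by move=> m n _ _ /y_inj.
Qed.
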